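(* Assume that the following statement (Conjecture A) holds for all integers $n>1$ and all positive integers $a,b$ with $a+b=n+1$: for all division rings $F,G$, every ring embedding $\varphi:F\to M_n(G)$ and every $a\times b$ matrix $A$ with entries from $G$, there exist division ring extensions $G\subseteq G'$ and $F\subseteq F'$ and a ring embedding $\varphi':F'\to M_n(G')$ such that $\varphi'\restriction F=\varphi$ and $\operatorname{Im}(\varphi')$ contains a matrix whose upper right $a\times b$ block is $A$. Then for every positive integer $n$ there exist division rings $F,G$ and a tight embedding $\varphi:F\to M_n(G)$.
   Context: Rings are associative and unital; ring embeddings are injective unital ring homomorphisms. For $G\subseteq G'$, $M_n(G)$ is regarded as a subring of $M_n(G')$. Tightness: let $\varphi:F\to M_n(G)$ be a ring embedding with $F,G$ division rings. For positive integers $a,b$ with $a+b=n+1$, $\varphi$ is called $a$-tight if for every $a\times b$ matrix $g$ with entries from $G$ there exists $f\in F$ such that the upper right $a\times b$ corner block of $\varphi(f)$ is $g$. The embedding $\varphi$ is called tight if it is $a$-tight for each $a\in\{1,2,\dots,n\}$. *)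

(* Defs.v *)
From HB Require Import structures.
From mathcomp Require Import all_boot all_order all_algebra.

Set Implicit Arguments.
Unset Strict Implicit.
Unset Printing Implicit Defensive.

Import GRing.Theory.
Local Open Scope ring_scope.

Definition division_ring (R : unitRingType) : Prop := GRing.field_axiom R.

Lemma block_rows_le (n a b : nat) : (0 < b -> a + b = n.+1 -> a <= n)%N.
Proof. by case: b => // b _; rewrite addnS => -[<-]; apply: leq_addr. Qed.

Lemma block_cols_le (n a b : nat) : (0 < a -> a + b = n.+1 -> b <= n)%N.
Proof. by rewrite addnC; apply: block_rows_le. Qed.

(* The casts decompose the rows as n = a + (n - a) and the columns as
   n = (n - b) + b, so the block consists of the first a rows and the last b
   columns; since a + b = n.+1, its lower left entry lies on the diagonal of M. *)
Definition ur_block (R : Type) (n a b : nat) (a_gt0 : (0 < a)%N)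
    (b_gt0 : (0 < b)%N) (abn : (a + b)%N = n.+1) (M : 'M[R]_n) : 'M[R]_(a, b) :=
  ursubmx (castmx (esym (subnKC (block_rows_le b_gt0 abn)),
                   esym (subnK (block_cols_le a_gt0 abn))) M).

Definition a_tight (F G : unitRingType) (n : nat) (phi : F -> 'M[G]_n)
    (a : nat) : Prop :=
  forall (b : nat) (a_gt0 : (0 < a)%N) (b_gt0 : (0 < b)%N)
         (abn : (a + b)%N = n.+1) (g : 'M[G]_(a, b)),
    exists f : F, ur_block a_gt0 b_gt0 abn (phi f) = g.

Definition tight (F G : unitRingType) (n : nat) (phi : F -> 'M[G]_n) : Prop :=
  forall a : nat, (1 <= a <= n)%N -> a_tight phi a.

(* An extension G ⊆ G' is an embedding iG : G -> G', which makes M_n(G) a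
   subring of M_n(G') through map_mx iG; likewise for F ⊆ F'. *)
Definition conjectureA (n a b : nat) (a_gt0 : (0 < a)%N) (b_gt0 : (0 < b)%N)
    (abn : (a + b)%N = n.+1) : Prop :=
  forall F G : unitRingType, division_ring F -> division_ring G ->
  forall phi : {rmorphism F -> 'M[G]_n}, injective phi ->
  forall A : 'M[G]_(a, b),
  exists (G' F' : unitRingType) (iG : {rmorphism G -> G'})
         (iF : {rmorphism F -> F'}) (phi' : {rmorphism F' -> 'M[G']_n}),
    [/\ division_ring G' /\ division_ring F',
        injective iG /\ injective iF,
        injective phi',
        forall x : F, phi' (iF x) = map_mx iG (phi x)
      & exists f : F', ur_block a_gt0 b_gt0 abn (phi' f) = map_mx iG A].

(* Main.v *)
(** Start from the scalar embedding of the rationals and iterate Conjecture A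
    along a chain E_0 -> E_1 -> ... of embeddings of division rings, the k-th
    step adjoining a witness x_k whose image has a prescribed upper right block.
    In the direct limit, take the division ring F generated by the x_k and the
    division ring G generated by the entries of their images.  Both are
    countable, their elements being named by formal ring terms; so all blocks
    over G can be prescribed along the chain, and the limit embedding
    F -> M_n(G) is tight.  Concretely, F and G are the formal terms modulo
    eventual equality of their values in the E_k. *)

Require Import Defs.
From HB Require Import structures.
From mathcomp Require Import all_boot all_order all_algebra.
From mathcomp Require Import boolp.

Set Implicit Arguments.
Unset Strict Implicit.
Unset Printing Implicit Defensive.

Import GRing.Theory.
Local Open Scope ring_scope.
Local Open Scope quotient_scope.

(** * Properties of all late stages *)

Definition eventually (P : nat -> Prop) : Prop :=
  exists N : nat, forall k : nat, (N <= k)%N -> P k.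

Lemma eventually_always (P : nat -> Prop) : (forall k, P k) -> eventually P.
Proof. by exists 0%N. Qed.

Lemma eventually_and (P Q : nat -> Prop) :
  eventually P -> eventually Q -> eventually (fun k => P k /\ Q k).
Proof.
move=> [N NP] [M MQ]; exists (maxn N M) => k; rewrite geq_max => /andP[Nk Mk].
by split; [apply: NP | apply: MQ].
Qed.

Lemma eventually_imp (P Q : nat -> Prop) :
  (forall k, P k -> Q k) -> eventually P -> eventually Q.
Proof. by move=> PQ [N NP]; exists N => k /NP /PQ. Qed.

Lemma eventually_imp2 (P Q S : nat -> Prop) :
  (forall k, P k -> Q k -> S k) ->
  eventually P -> eventually Q -> eventually S.
Proof.
move=> PQS hP hQ; apply: eventually_imp (eventually_and hP hQ) => k [].
exact: PQS.
Qed.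

Lemma eventually_forall (I : finType) (P : I -> nat -> Prop) :
  (forall i, eventually (P i)) -> eventually (fun k => forall i, P i k).
Proof.
move=> /fin_all_exists[N NP]; exists (\max_i N i) => k leNk i.
by apply: NP; apply: leq_trans leNk; apply: leq_bigmax.
Qed.

(** * Formal ring terms and their values *)

Inductive term (V : Type) : Type :=
| Var of V
| Zero
| One
| Opp of term V
| Add of term V & term V
| Mul of term V & term V
| Inv of term V.

Arguments Zero {V}.
Arguments One {V}.

Section TermCountable.
Variable V : countType.

Fixpoint term_encode (t : term V) : GenTree.tree V :=
  match t with
  | Var v => GenTree.Leaf v
  | Zero => GenTree.Node 0 [::]
  | One => GenTree.Node 1 [::]
  | Opp s => GenTree.Node 2 [:: term_encode s]
  | Add s u => GenTree.Node 3 [:: term_encode s; term_encode u]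
  | Mul s u => GenTree.Node 4 [:: term_encode s; term_encode u]
  | Inv s => GenTree.Node 5 [:: term_encode s]
  end.

(** The default [Zero] serves both the label 0 and the trees that encode no term. *)
Fixpoint term_decode (t : GenTree.tree V) : term V :=
  match t with
  | GenTree.Leaf v => Var v
  | GenTree.Node 1 _ => One
  | GenTree.Node 2 [:: s] => Opp (term_decode s)
  | GenTree.Node 3 [:: s; u] => Add (term_decode s) (term_decode u)
  | GenTree.Node 4 [:: s; u] => Mul (term_decode s) (term_decode u)
  | GenTree.Node 5 [:: s] => Inv (term_decode s)
  | _ => Zero
  end.

Lemma term_encodeK : cancel term_encode term_decode.
Proof.
by elim=> //= [s -> | s -> u -> | s -> u -> | s ->].
Qed.

HB.instance Definition _ := Countable.copy (term V) (can_type term_encodeK).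
End TermCountable.

Fixpoint eval (V : Type) (R : unitRingType) (e : V -> R) (t : term V) : R :=
  match t with
  | Var v => e v
  | Zero => 0
  | One => 1
  | Opp s => - eval e s
  | Add s u => eval e s + eval e u
  | Mul s u => eval e s * eval e u
  | Inv s => (eval e s)^-1
  end.

(** A nonzero element is a unit and 0 is its own formal inverse, so no side condition is left; this
    lets [Inv] be applied to any term. *)
Lemma division_ring_rmorphV (R S : unitRingType) (f : {rmorphism R -> S}) :
  division_ring R -> {morph f : x / x^-1}.
Proof.
move=> Rdiv x; have [-> | x0] := eqVneq x 0.
  by rewrite invr0 !rmorph0 invr0.
by rewrite rmorphV // Rdiv.
Qed.

(** * The division ring of germs of terms *)

Section GermRing.
Variables (V : countType) (R : nat -> unitRingType) (e : forall k, V -> R k).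
Variable i : forall k, {rmorphism R k -> R k.+1}.
Hypothesis Rdiv : forall k, division_ring (R k).
Hypothesis e_coherent :
  forall v, eventually (fun k => e k.+1 v = i k (e k v)).

(** A term has finitely many variables, so their thresholds have a common bound. *)
Lemma eval_coherent (t : term V) :
  eventually (fun k => eval (@e k.+1) t = i k (eval (@e k) t)).
Proof.
elim: t => [v | | | s IHs | s IHs u IHu | s IHs u IHu | s IHs] /=.
- exact: e_coherent.
- by apply: eventually_always => k; rewrite rmorph0.
- by apply: eventually_always => k; rewrite rmorph1.
- by apply: eventually_imp IHs => k ->; rewrite rmorphN.
- by apply: eventually_imp2 IHs IHu => k -> ->; rewrite rmorphD.
- by apply: eventually_imp2 IHs IHu => k -> ->; rewrite rmorphM.
- by apply: eventually_imp IHs => k ->; rewrite division_ring_rmorphV.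
Qed.

(** Terms are evaluated afresh at each stage, so the limit is a quotient of one countable type and
    the relation needs no transition maps. *)
Definition germ_rel (s t : term V) : bool :=
  `[< eventually (fun k => eval (@e k) s = eval (@e k) t) >].

Lemma germ_rel_refl : reflexive germ_rel.
Proof. by move=> s; apply/asboolP; apply: eventually_always. Qed.

Lemma germ_rel_sym : symmetric germ_rel.
Proof.
by move=> s t; apply/asboolP/asboolP; apply: eventually_imp => k ->.
Qed.

Lemma germ_rel_trans : transitive germ_rel.
Proof.
move=> t s u /asboolP st /asboolP tu; apply/asboolP.
by apply: eventually_imp2 st tu => k ->.
Qed.

Canonical germ_equiv :=
  EquivRel germ_rel germ_rel_refl germ_rel_sym germ_rel_trans.

Definition germs := {eq_quot germ_equiv}.
HB.instance Definition _ := Choice.on germs.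
HB.instance Definition _ := EqQuotient.on germs.

Definition germ (t : term V) : germs := \pi_germs%qT t.

Lemma germP (s t : term V) :
  germ s = germ t <-> eventually (fun k => eval (@e k) s = eval (@e k) t).
Proof.
split=> [/eqP | st]; first by rewrite /germ piE => /asboolP.
by apply/eqP; rewrite /germ piE; apply/asboolP.
Qed.

Lemma germ_repr (x : germs) : germ (repr x) = x.
Proof. exact: reprK. Qed.

Lemma repr_germ (t : term V) :
  eventually (fun k => eval (@e k) (repr (germ t)) = eval (@e k) t).
Proof. by apply/germP; rewrite germ_repr. Qed.

(* An equality of coherent threads at one late stage persists at later ones. *)
Lemma germ_neq (s t : term V) :
  germ s <> germ t -> eventually (fun k => eval (@e k) s <> eval (@e k) t).
Proof.
move=> neq_st.
have [N Ncoh] := eventually_and (eval_coherent s) (eval_coherent t).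
exists N => k leNk eq_k; apply: neq_st; apply/germP; exists k => m.
elim: m => [|m IHm]; first by rewrite leqn0 => /eqP <-.
rewrite leq_eqVlt => /predU1P[<- // | lekm].
have [-> ->] := Ncoh m (leq_trans leNk lekm).
by rewrite IHm.
Qed.

Definition germ_opp (x : germs) := germ (Opp (repr x)).
Definition germ_add (x y : germs) := germ (Add (repr x) (repr y)).
Definition germ_mul (x y : germs) := germ (Mul (repr x) (repr y)).
Definition germ_inv (x : germs) := germ (Inv (repr x)).

Lemma germ_oppE s : germ_opp (germ s) = germ (Opp s).
Proof. by apply/germP; apply: eventually_imp (repr_germ s) => k /= ->. Qed.

Lemma germ_addE s t : germ_add (germ s) (germ t) = germ (Add s t).
Proof.
apply/germP; apply: eventually_imp2 (repr_germ s) (repr_germ t) => k /=.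
by move=> -> ->.
Qed.

Lemma germ_mulE s t : germ_mul (germ s) (germ t) = germ (Mul s t).
Proof.
apply/germP; apply: eventually_imp2 (repr_germ s) (repr_germ t) => k /=.
by move=> -> ->.
Qed.

Lemma germ_invE s : germ_inv (germ s) = germ (Inv s).
Proof. by apply/germP; apply: eventually_imp (repr_germ s) => k /= ->. Qed.

Let germE := (germ_oppE, germ_addE, germ_mulE, germ_invE).

Lemma germ_ind (P : germs -> Prop) : (forall t, P (germ t)) -> forall x, P x.
Proof. by move=> Pgerm x; rewrite -[x]germ_repr. Qed.

Lemma germ_addA : associative germ_add.
Proof.
elim/germ_ind=> s; elim/germ_ind=> t; elim/germ_ind=> u; rewrite !germE.
by apply/germP; apply: eventually_always => k /=; rewrite addrA.
Qed.

Lemma germ_addC : commutative germ_add.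
Proof.
elim/germ_ind=> s; elim/germ_ind=> t; rewrite !germE.
by apply/germP; apply: eventually_always => k /=; rewrite addrC.
Qed.

Lemma germ_add0 : left_id (germ Zero) germ_add.
Proof.
elim/germ_ind=> s; rewrite !germE.
by apply/germP; apply: eventually_always => k /=; rewrite add0r.
Qed.

Lemma germ_addN : left_inverse (germ Zero) germ_opp germ_add.
Proof.
elim/germ_ind=> s; rewrite !germE.
by apply/germP; apply: eventually_always => k /=; rewrite addNr.
Qed.

HB.instance Definition _ :=
  GRing.isZmodule.Build germs germ_addA germ_addC germ_add0 germ_addN.

Lemma germ_mulA : associative germ_mul.
Proof.
elim/germ_ind=> s; elim/germ_ind=> t; elim/germ_ind=> u; rewrite !germE.
by apply/germP; apply: eventually_always => k /=; rewrite mulrA.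
Qed.

Lemma germ_mul1l : left_id (germ One) germ_mul.
Proof.
elim/germ_ind=> s; rewrite !germE.
by apply/germP; apply: eventually_always => k /=; rewrite mul1r.
Qed.

Lemma germ_mul1r : right_id (germ One) germ_mul.
Proof.
elim/germ_ind=> s; rewrite !germE.
by apply/germP; apply: eventually_always => k /=; rewrite mulr1.
Qed.

Lemma germ_mulDl : left_distributive germ_mul germ_add.
Proof.
elim/germ_ind=> s; elim/germ_ind=> t; elim/germ_ind=> u; rewrite !germE.
by apply/germP; apply: eventually_always => k /=; rewrite mulrDl.
Qed.

Lemma germ_mulDr : right_distributive germ_mul germ_add.
Proof.
elim/germ_ind=> s; elim/germ_ind=> t; elim/germ_ind=> u; rewrite !germE.
by apply/germP; apply: eventually_always => k /=; rewrite mulrDr.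
Qed.

Lemma germ_one_neq0 : germ One != 0.
Proof.
apply/eqP => /germP[N /(_ N (leqnn N)) /= /eqP]; exact/negP/oner_neq0.
Qed.

HB.instance Definition _ := GRing.Zmodule_isNzRing.Build germs
  germ_mulA germ_mul1l germ_mul1r germ_mulDl germ_mulDr germ_one_neq0.

(** By coherence, a term that does not vanish eventually is eventually nonzero; the division rings
    of the chain then invert it. *)
Lemma germ_neq0_unit s :
  germ s != 0 -> eventually (fun k => eval (@e k) s \is a GRing.unit).
Proof.
move=> /eqP /germ_neq; apply: eventually_imp => k /eqP s0.
exact: Rdiv s0.
Qed.

Lemma germ_mulV : {in (fun x : germs => x != 0), left_inverse 1 germ_inv *%R}.
Proof.
elim/germ_ind=> s /germ_neq0_unit s_unit; rewrite /GRing.mul /= !germE.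
by apply/germP; apply: eventually_imp s_unit => k /= /mulVr.
Qed.

Lemma germ_divr : {in (fun x : germs => x != 0), right_inverse 1 germ_inv *%R}.
Proof.
elim/germ_ind=> s /germ_neq0_unit s_unit; rewrite /GRing.mul /= !germE.
by apply/germP; apply: eventually_imp s_unit => k /= /mulrV.
Qed.

Lemma germ_unitP (x y : germs) : y * x = 1 /\ x * y = 1 -> x != 0.
Proof.
by case=> yx _; apply: contra_eq_neq yx => ->; rewrite mulr0 eq_sym oner_neq0.
Qed.

Lemma germ_inv_out : {in [predC (fun x : germs => x != 0)], germ_inv =1 id}.
Proof.
move=> x; rewrite inE negbK => /eqP ->.
have -> : (0 : germs) = germ Zero by [].
rewrite germE; apply/germP.
by apply: eventually_always => k /=; rewrite invr0.
Qed.

HB.instance Definition _ := GRing.NzRing_hasMulInverse.Build germs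
  germ_mulV germ_divr germ_unitP germ_inv_out.

(* The ring structure depends on the coherence data, which unification cannot
   recover from the type [germs], hence this explicit package. *)
Definition germ_ring : unitRingType := germs.

Lemma germ_ring_division : division_ring germ_ring.
Proof. by []. Qed.

Lemma germ1 : germ One = 1 :> germ_ring.
Proof. by []. Qed.

Lemma germ0 : germ Zero = 0 :> germ_ring.
Proof. by []. Qed.

Lemma germD s t : germ (Add s t) = germ s + germ t :> germ_ring.
Proof. by rewrite -germ_addE. Qed.

Lemma germB s t : germ (Add s (Opp t)) = germ s - germ t :> germ_ring.
Proof. by rewrite -germ_addE -germ_oppE. Qed.

Lemma germM s t : germ (Mul s t) = germ s * germ t :> germ_ring.
Proof. by rewrite -germ_mulE. Qed.

End GermRing.

(** * Blocks, injectivity and a recurrent enumeration *)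

Lemma ur_block_map (R S : Type) (f : R -> S) (n a b : nat) (a_gt0 : (0 < a)%N)
    (b_gt0 : (0 < b)%N) (abn : (a + b)%N = n.+1) (M : 'M[R]_n) :
  ur_block a_gt0 b_gt0 abn (map_mx f M) = map_mx f (ur_block a_gt0 b_gt0 abn M).
Proof. by rewrite /ur_block -map_castmx map_ursubmx. Qed.

(** A nonzero element of the kernel would be invertible, forcing 1 = 0. Injectivity thus need not be
    carried along the chain. *)
Lemma division_ring_rmorph_inj (F : unitRingType) (R : pzRingType)
    (f : {rmorphism F -> R}) :
  division_ring F -> 1 != 0 :> R -> injective f.
Proof.
move=> Fdiv R1; apply: raddf_inj => x fx0; apply/eqP; apply: contraNT R1 => x0.
by rewrite -(rmorph1 f) -(divrr (Fdiv x x0)) rmorphM fx0 mul0r.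
Qed.

Lemma oner_mx_neq0 (G : nzRingType) (n : nat) : (0 < n)%N -> 1 != 0 :> 'M[G]_n.
Proof. by case: n => // n _; apply: oner_neq0. Qed.

(* The block named by a task has its intended value only late in the chain, so a
   task must come up again after every stage. *)
Lemma recurrent_enumeration (T : countType) :
  exists o : nat -> option T, forall x N, exists2 k, (N <= k)%N & o k = Some x.
Proof.
(* Each code is the 2-adic valuation of arbitrarily large numbers: the odd factor [N.*2.+1] enlarges
   the index and keeps the valuation. *)
exists (fun k => unpickle (logn 2 k)) => x N.
exists (2 ^ pickle x * N.*2.+1)%N.
  apply: leq_trans (leq_pmull _ (expn_gt0 2 _)).
  by rewrite -addnn leqW // leq_addr.
rewrite lognM ?expn_gt0 // pfactorK // lognE /= dvdn2 /= odd_double /= addn0.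
by rewrite pickleK.
Qed.

(** * Stages and the chain of extensions *)

(* [stage_wit k] is meaningful from stage [k.+1] on. *)
Record stage (n : nat) := Stage {
  stage_dom : unitRingType;
  stage_cod : unitRingType;
  stage_emb : {rmorphism stage_dom -> 'M[stage_cod]_n};
  stage_wit : nat -> stage_dom;
  stage_dom_div : division_ring stage_dom;
  stage_cod_div : division_ring stage_cod
}.

Section Stages.
Variable n : nat.
Hypothesis n_gt0 : (0 < n)%N.

(* [(t, i, j)] names the (i, j) entry of the image of the element named [t]. *)
Definition entry : Type := term nat * 'I_n * 'I_n.
HB.instance Definition _ := Countable.on entry.

Definition entry_value (S : stage n) (v : entry) : stage_cod S :=
  stage_emb S (eval (@stage_wit n S) v.1.1) v.1.2 v.2.

(* A block size (a, b) together with names of the entries of a prescribed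
   block. *)
Definition task : Type := {ab : nat * nat & 'M[term entry]_(ab.1, ab.2)}.
HB.instance Definition _ := Countable.on task.

(** The names in [T] may involve the very witness being replaced, so the block is read in [S] and
    then transported. Tasks of impossible size are fulfilled vacuously. *)
Definition fulfils (S S' : stage n) (iG : stage_cod S -> stage_cod S')
    (f : stage_dom S') (T : task) : Prop :=
  forall (a_gt0 : (0 < (tag T).1)%N) (b_gt0 : (0 < (tag T).2)%N)
         (abn : ((tag T).1 + (tag T).2)%N = n.+1),
    ur_block a_gt0 b_gt0 abn (stage_emb S' f) =
    map_mx iG (map_mx (eval (entry_value S)) (tagged T)).

Record stage_ext (k : nat) (o : option task) (S S' : stage n) := StageExt {
  ext_dom : {rmorphism stage_dom S -> stage_dom S'};
  ext_cod : {rmorphism stage_cod S -> stage_cod S'};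
  ext_emb : forall x, stage_emb S' (ext_dom x) = map_mx ext_cod (stage_emb S x);
  ext_wit : forall j, j != k ->
    stage_wit S' j = ext_dom (stage_wit S j);
  ext_fulfils : forall T, o = Some T -> fulfils ext_cod (stage_wit S' k) T
}.

Lemma stage_ext_exists (k : nat) (o : option task) (S : stage n) :
  (forall (a b : nat) (a_gt0 : (0 < a)%N) (b_gt0 : (0 < b)%N)
      (abn : (a + b)%N = n.+1), conjectureA a_gt0 b_gt0 abn) ->
  exists S', inhabited (stage_ext k o S S').
Proof.
move=> hA.
(* The stage is repeated when there is no task, or one of impossible size. *)
have trivial_ext : (forall T, o = Some T -> fulfils idfun (stage_wit S k) T) ->
    exists S', inhabited (stage_ext k o S S').
  move=> oS; exists S; constructor.
  apply: (@StageExt k o S S idfun idfun) => //= x.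
  by rewrite map_mx_id.
case: o trivial_ext => [[[a b] A] | triv]; last by apply: triv.
have [/and3P[a_gt0 b_gt0 /eqP abn] _ | inval triv] :=
  boolP [&& (0 < a)%N, (0 < b)%N & (a + b)%N == n.+1]; last first.
  apply: triv => _ [<-] a_gt0 b_gt0 abn; case/negP: inval.
  by apply/and3P; split=> //; apply/eqP.
have emb_inj : injective (stage_emb S).
  apply: division_ring_rmorph_inj; first exact: stage_dom_div.
  exact: oner_mx_neq0.
have [G' [F' [iG [iF [phi' [[G'div F'div] _ _ phi'E [f fA]]]]]]] :=
  hA a b a_gt0 b_gt0 abn _ _ (@stage_dom_div _ S) (@stage_cod_div _ S) _ emb_inj
     (map_mx (eval (entry_value S)) A).
pose wit j := if j == k then f else iF (stage_wit S j).
exists (Stage phi' wit F'div G'div).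
set S' := Stage _ _ _ _.
constructor; apply: (@StageExt k _ S S' iF iG) => //= [j /negPf neq_jk | T [<-]];
  rewrite /wit ?neq_jk //.
move=> a_gt0' b_gt0' abn' /=; rewrite eqxx -fA (eq_irrelevance abn' abn).
by rewrite (bool_irrelevance a_gt0' a_gt0) (bool_irrelevance b_gt0' b_gt0).
Qed.

Lemma stage_chain :
  (forall (a b : nat) (a_gt0 : (0 < a)%N) (b_gt0 : (0 < b)%N)
      (abn : (a + b)%N = n.+1), conjectureA a_gt0 b_gt0 abn) ->
  forall (o : nat -> option task) (S0 : stage n),
  exists S : nat -> stage n,
    forall k, inhabited (stage_ext k (o k) (S k) (S k.+1)).
Proof.
move=> hA o S0.
(* Choosing for all indices and stages at once reduces the chain to plain recursion. *)
have /choice[next nextP] (kS : nat * stage n) :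
    exists S', inhabited (stage_ext kS.1 (o kS.1) kS.2 S').
  exact: stage_ext_exists.
exists (fix S k := if k is j.+1 then next (j, S j) else S0) => k.
exact: (nextP (k, _)).
Qed.

(** The witnesses 0 are placeholders; step [k] may overwrite the one of index [k]. *)
Definition rat_stage : stage n.
Proof.
by apply: (@Stage n rat rat scalar_mx (fun=> 0)) => x; rewrite unitfE.
Defined.

End Stages.

(** * The limit embedding and its tightness *)

Section StageLimit.
Variables (n : nat) (o : nat -> option (task n)) (S : nat -> stage n).
Variable ext : forall k, stage_ext k (o k) (S k) (S k.+1).

Local Notation iF k := (ext_dom (ext k)).
Local Notation iG k := (ext_cod (ext k)).

(** Only step [j] may overwrite witness [j], hence the threshold [j.+1]. *)
Lemma stage_wit_coherent j :
  eventually (fun k => stage_wit (S k.+1) j = iF k (stage_wit (S k) j)).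
Proof. by exists j.+1 => k lt_jk; rewrite (ext_wit (ext k)) // ltn_eqF. Qed.

Definition dom_eval k : term nat -> stage_dom (S k) :=
  eval (@stage_wit n (S k)).
Definition cod_eval k : term (entry n) -> stage_cod (S k) :=
  eval (@entry_value n (S k)).

Lemma dom_eval_coherent t :
  eventually (fun k => dom_eval k.+1 t = iF k (dom_eval k t)).
Proof.
exact: (eval_coherent (fun k => @stage_dom_div n (S k)) stage_wit_coherent).
Qed.

Lemma entry_value_coherent v :
  eventually (fun k => entry_value (S k.+1) v = iG k (entry_value (S k) v)).
Proof.
have := dom_eval_coherent v.1.1; apply: eventually_imp => k.
by rewrite /entry_value /dom_eval => ->; rewrite ext_emb mxE.
Qed.

Definition limit_dom : unitRingType :=
  germ_ring (fun k => @stage_dom_div n (S k)) stage_wit_coherent.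
Definition limit_cod : unitRingType :=
  germ_ring (fun k => @stage_cod_div n (S k)) entry_value_coherent.

Definition dom_germ (t : term nat) : limit_dom :=
  germ (fun k => stage_wit (S k)) t.
Definition cod_germ (t : term (entry n)) : limit_cod :=
  germ (fun k => entry_value (S k)) t.

Definition dom_repr (x : limit_dom) : term nat :=
  repr (x : germs (fun k => stage_wit (S k))).
Definition cod_repr (x : limit_cod) : term (entry n) :=
  repr (x : germs (fun k => entry_value (S k))).

Lemma dom_reprK : cancel dom_repr dom_germ.
Proof. exact: germ_repr. Qed.

Lemma cod_reprK : cancel cod_repr cod_germ.
Proof. exact: germ_repr. Qed.

(** An entry of a matrix product must become the germ of a single formal sum before it can be
    compared stage by stage. *)
Lemma cod_germ_sum (I : finType) (t : I -> term (entry n)) :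
  \sum_i cod_germ (t i) = cod_germ (\big[@Add _/Zero]_i t i).
Proof. by rewrite (big_morph cod_germ (germD _ _) (germ0 _ _)). Qed.

Lemma cod_eval_sum k (I : finType) (t : I -> term (entry n)) :
  cod_eval k (\big[@Add _/Zero]_i t i) = \sum_i cod_eval k (t i).
Proof. exact: (big_morph (cod_eval k)). Qed.

Definition limit_emb (x : limit_dom) : 'M[limit_cod]_n :=
  \matrix_(i, j) cod_germ (Var (dom_repr x, i, j)).

(** At each stage an entry depends only on the value of the term [t], so the chosen representative
    is immaterial. *)
Lemma limit_embE t :
  limit_emb (dom_germ t) = \matrix_(i, j) cod_germ (Var (t, i, j)).
Proof.
apply/matrixP => i j; rewrite !mxE; apply/germP.
have := repr_germ (fun k => @stage_wit n (S k)) t.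
by apply: eventually_imp => k /= eq_t; rewrite /entry_value /= -eq_t.
Qed.

Lemma limit_emb_zmod_morphism : zmod_morphism limit_emb.
Proof.
move=> x y; rewrite -[x]dom_reprK -[y]dom_reprK -[_ - _]germB !limit_embE.
apply/matrixP => i j; rewrite !mxE -[RHS]germB; apply/germP.
by apply: eventually_always => k /=; rewrite /entry_value /= rmorphB !mxE.
Qed.

Lemma limit_emb_monoid_morphism : monoid_morphism limit_emb.
Proof.
split.
  rewrite -[1]germ1 limit_embE; apply/matrixP => i j; rewrite !mxE.
  have [-> | neq_ij] := eqVneq i j; rewrite -?germ1 -?germ0; apply/germP;
    apply: eventually_always => k /=; rewrite /entry_value /= rmorph1 mxE.
    by rewrite eqxx.
  by rewrite (negPf neq_ij).
move=> x y; rewrite -[x]dom_reprK -[y]dom_reprK -[_ * _]germM !limit_embE.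
apply/matrixP => i j; rewrite !mxE.
under eq_bigr => l _ do rewrite !mxE -[_ * _]germM.
rewrite cod_germ_sum; apply/germP; apply: eventually_always => k.
rewrite -/(cod_eval k _) -/(cod_eval k _) cod_eval_sum.
by rewrite /cod_eval /= /entry_value /= rmorphM mxE.
Qed.

HB.instance Definition _ :=
  GRing.isZmodMorphism.Build limit_dom 'M[limit_cod]_n limit_emb
    limit_emb_zmod_morphism.
HB.instance Definition _ :=
  GRing.isMonoidMorphism.Build limit_dom 'M[limit_cod]_n limit_emb
    limit_emb_monoid_morphism.

(** A block over the limit has finitely many entries, so its names are coherent from some stage on;
    a later step fulfils the corresponding task, and coherence preserves the agreement. *)
Lemma limit_emb_tight :
  (forall T N, exists2 k, (N <= k)%N & o k = Some T) -> tight limit_emb.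
Proof.
move=> o_rec a _ b a_gt0 b_gt0 abn g.
pose A : 'M[term (entry n)]_(a, b) := map_mx cod_repr g.
have A_coh : eventually (fun k => forall ij : 'I_a * 'I_b,
    cod_eval k.+1 (A ij.1 ij.2) = iG k (cod_eval k (A ij.1 ij.2))).
  apply: eventually_forall => ij.
  exact: (eval_coherent (fun k => @stage_cod_div n (S k)) entry_value_coherent).
have [N Ncoh] := A_coh.
(* As [k] is at least [N], overwriting witness [k] does not disturb the values of [A]. *)
have [k leNk ok] := o_rec (existT _ (a, b) A) N.
exists (dom_germ (Var k)).
have A_k m : (k < m)%N ->
    ur_block a_gt0 b_gt0 abn (stage_emb (S m) (stage_wit (S m) k)) =
    map_mx (cod_eval m) A.
  elim: m => // m IHm; rewrite ltnS leq_eqVlt => lekm.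
  have step : map_mx (cod_eval m.+1) A = map_mx (iG m) (map_mx (cod_eval m) A).
    apply/matrixP => i j; rewrite !(mxE, Ncoh m _ (i, j)) //.
    by apply: leq_trans leNk _; rewrite leq_eqVlt.
  (* For [m = k] the block is the one just prescribed; afterwards both sides are transported. *)
  rewrite step; have [Ekm | ltkm] := predU1P lekm.
    by subst m; apply: (ext_fulfils (ext k) ok).
  by rewrite (ext_wit (ext m)) ?ltn_eqF // ext_emb ur_block_map IHm.
(* With a matrix of names, taking the block commutes with both germs and evaluation. *)
pose X : 'M[term (entry n)]_n := \matrix_(i, j) Var (Var k, i, j).
have -> : limit_emb (dom_germ (Var k)) = map_mx cod_germ X.
  by rewrite limit_embE; apply/matrixP => i j; rewrite !mxE.
rewrite ur_block_map; apply/matrixP => i j; rewrite mxE -[RHS]cod_reprK.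
apply/germP; exists k.+1 => m /A_k A_m.
have X_m : map_mx (cod_eval m) X = stage_emb (S m) (stage_wit (S m) k).
  by apply/matrixP => i' j'; rewrite !mxE.
transitivity (map_mx (cod_eval m) (ur_block a_gt0 b_gt0 abn X) i j).
  by rewrite [RHS]mxE.
by rewrite -ur_block_map X_m A_m !mxE.
Qed.

End StageLimit.

Arguments limit_emb {n o S} ext x.

(** * Existence of tight embeddings *)

Theorem proposition3p1
  (hA : forall (n a b : nat), (1 < n)%N ->
        forall (a_gt0 : (0 < a)%N) (b_gt0 : (0 < b)%N)
               (abn : (a + b)%N = n.+1),
          conjectureA a_gt0 b_gt0 abn)
  (n : nat) (n_gt0 : (0 < n)%N) :
  exists (F G : unitRingType) (phi : {rmorphism F -> 'M[G]_n}),
    [/\ division_ring F, division_ring G, injective phi & tight phi].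
Proof.
(* The conjecture is assumed only for [n > 1]; for [n = 1] the block is the whole matrix and scalar
   matrices suffice. *)
have [n1 | n_neq1] := eqVneq n 1%N.
  subst n; exists rat, rat, (scalar_mx : {rmorphism rat -> 'M[rat]_1}); split.
  - by move=> x; rewrite unitfE.
  - by move=> x; rewrite unitfE.
  - by move=> x y /matrixP/(_ 0 0); rewrite !mxE.
  move=> a /andP[_ a_le1] b a_gt0 b_gt0 abn.
  have Ea : a = 1%N by apply/eqP; rewrite eqn_leq a_le1.
  subst a; have Eb : b = 1%N by case: abn.
  subst b => g; exists (g 0 0); apply/matrixP => i j.
  by rewrite /ur_block !(mxE, castmxE) /= !ord1 eqxx.
have n_gt1 : (1 < n)%N by rewrite ltn_neqAle eq_sym n_neq1.
have [o o_rec] := recurrent_enumeration (task n).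
have [S S_ext] := stage_chain n_gt0 (fun a b => hA n a b n_gt1) o (rat_stage n).
pose ext k := inhabited_witness (S_ext k).
exists (limit_dom ext), (limit_cod ext), (limit_emb ext); split.
- exact: germ_ring_division.
- exact: germ_ring_division.
- apply: division_ring_rmorph_inj (oner_mx_neq0 _ n_gt0).
  exact: germ_ring_division.
- exact: limit_emb_tight.
Qed.
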